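(* $b(G_{2,2})=3$ and $b(G_{3,2})=2$. Moreover, for every integer $n\geq 4$: $b(G_{n,2})=1$ if $n$ is odd, and $b(G_{n,2})=2$ if $n$ is even.
   Context: All graphs are finite, simple and undirected. For positive integers $n,m$, the mesh $G_{n,m}=P_n\times P_m$ is the Cartesian product of paths on $n$ and $m$ vertices: its vertex set is $\{u_{i,j} : 1\leq i\leq n,\ 1\leq j\leq m\}$, and $u_{i,j}$ is adjacent to $u_{k,l}$ iff $|i-k|+|j-l|=1$. A nonempty set $D\subseteq V(G)$ is a dominating set of $G$ if every vertex of $G$ is in $D$ or adjacent to a vertex of $D$; the domination number $\gamma(G)$ is the minimum cardinality of a dominating set. For a graph $G$ with at least one edge, the bondage number is $b(G)=\min\{|B| : B\subseteq E(G),\ \gamma(G-B)>\gamma(G)\}$, where $G-B$ is obtained from $G$ by deleting the edges in $B$ (keeping all vertices). *)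

(* Defs.v *)
From mathcomp Require Import all_boot.
From mathcomp Require Import ssralg ssrnum ssrint.

Set Implicit Arguments.
Unset Strict Implicit.
Unset Printing Implicit Defensive.

Import IntDist.

Record sgraph := SGraph {
  vertex :> finType;
  adj : rel vertex;
  adj_sym : symmetric adj;
  adj_irrefl : irreflexive adj
}.

Definition edges (G : sgraph) : {set {set G}} :=
  [set [set p.1; p.2] | p : G * G & adj p.1 p.2].

Section DeleteEdges.

Variables (G : sgraph) (B : {set {set G}}).

Definition del_adj : rel G :=
  [rel x y | adj x y && ([set x; y] \notin B)].

Lemma del_adj_sym : symmetric del_adj.
Proof. by move=> x y; rewrite /del_adj /= adj_sym setUC. Qed.

Lemma del_adj_irrefl : irreflexive del_adj.
Proof. by move=> x; rewrite /del_adj /= adj_irrefl. Qed.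

Definition del_edges : sgraph := SGraph del_adj_sym del_adj_irrefl.

End DeleteEdges.

Definition dominating (G : sgraph) (D : {set G}) : bool :=
  (D != set0) && [forall v : G, (v \in D) || [exists u in D, adj v u]].

(* The minimum is meaningful when G has a vertex: the whole vertex set is then
   dominating. *)
Definition domination_number (G : sgraph) : nat :=
  #|[arg min_(D < [set: G] | dominating D) #|D|]|.

Definition raises_domination (G : sgraph) (B : {set {set G}}) : bool :=
  (B \subset edges G) &&
  (domination_number G < domination_number (del_edges B)).

(* The minimum is meaningful when G has an edge: deleting all the edges then
   raises the domination number, see edges_raise_domination. *)
Definition bondage_number (G : sgraph) : nat :=
  #|[arg min_(B < edges G | raises_domination B) #|B|]|.

Section Mesh.

Variables n m : nat.

(* The vertex u_{i,j} is represented by the pair (i - 1, j - 1). *)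
Definition mesh_adj : rel ('I_n * 'I_m) :=
  [rel u v : 'I_n * 'I_m | `|u.1 - v.1| + `|u.2 - v.2| == 1].

Lemma mesh_adj_sym : symmetric mesh_adj.
Proof. by move=> u v; rewrite /mesh_adj /= distnC [X in _ + X]distnC. Qed.

Lemma mesh_adj_irrefl : irreflexive mesh_adj.
Proof. by move=> u; rewrite /mesh_adj /= !distnn. Qed.

Definition mesh : sgraph := SGraph mesh_adj_sym mesh_adj_irrefl.

End Mesh.

Lemma dominatingT (G : sgraph) (x : G) : dominating [set: G].
Proof.
apply/andP; split; first by apply/set0Pn; exists x.
by apply/forallP=> v; rewrite inE.
Qed.

Lemma domination_number_min (G : sgraph) (x : G) :
  (exists2 D : {set G}, dominating D & #|D| = domination_number G) /\
  (forall D : {set G}, dominating D -> domination_number G <= #|D|).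
Proof.
rewrite /domination_number; case: arg_minnP => [|D domD minD].
  exact: dominatingT x.
by split=> //; exists D.
Qed.

Lemma edges_raise_domination (G : sgraph) (x y : G) :
  adj x y -> raises_domination (edges G).
Proof.
move=> xy; rewrite /raises_domination subxx /=.
have yNx : y != x by apply: contraTneq xy => ->; rewrite adj_irrefl.
have domx : dominating [set~ x].
  apply/andP; split; first by apply/set0Pn; exists y; rewrite !inE.
  apply/forallP=> v; rewrite !inE; case: eqVneq => //= ->.
  by apply/existsP; exists y; rewrite !inE yNx.
have [_ /(_ _ domx) leG] := domination_number_min x.
have [[D domD <-] _] := @domination_number_min (del_edges (edges G)) x.
have -> : D = [set: G].
  apply/setP=> v; rewrite inE; case/andP: domD => _ /forallP/(_ v).
  case/orP=> // /existsP[u /andP[_ /andP[vu]]].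
  by case/imsetP; exists (v, u); rewrite ?inE.
by apply: leq_ltn_trans leG _; rewrite cardsC1 cardsT prednK //; apply/card_gt0P; exists x.
Qed.

Lemma bondage_number_min (G : sgraph) (x y : G) : adj x y ->
  (exists2 B : {set {set G}}, raises_domination B & #|B| = bondage_number G) /\
  (forall B : {set {set G}}, raises_domination B -> bondage_number G <= #|B|).
Proof.
move=> xy; rewrite /bondage_number; case: arg_minnP => [|B rB minB].
  exact: edges_raise_domination xy.
by split=> //; exists B.
Qed.

(* Main.v *)
Require Import Defs.
From mathcomp Require Import all_boot.
From mathcomp Require Import zify.

Set Implicit Arguments.
Unset Strict Implicit.
Unset Printing Implicit Defensive.

(** A ladder with n columns has domination number n/2 + 1, and the proof of
    this also decides which deletions raise it.

    Lower bounds only look at the numbers c_i of chosen vertices in each column.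
    If a set dominates, adding the domination conditions of the two vertices of
    column i gives 2 <= c_(i-1) + 2 c_i + c_(i+1) ([column_cover]).  Summing
    over the columns gives 2 n <= 4 |D| - c_0 - c_(n-1), and there is some
    further loss at the ends: an end column that contains no chosen vertex
    forces both vertices of the next column to be chosen, and these dominate
    each other.  So each end costs at least one unit, and one end already yields
    n/2 + 1 ([weight_block]).  For n odd and n >= 5 the two ends together use up
    all the slack of a set of this size, and deleting the rung of the first
    column makes that end cost two units ([weight_block_no_end_rung]): one edge
    is enough.  For n even, cutting the ladder after its second column gives two
    ladders with 2 and n - 2 columns, whose domination numbers add up to n/2 + 2
    ([cut_domination]); the same cut after the first column treats n = 3.

    Upper bounds come from zigzags: choose one vertex in every second column,
    alternating between the two rows, and add a vertex in an end column if
    needed.  A zigzag uses only the edges at its vertices in the columns of one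
    parity ([zigzag_dominates]).  Exchanging the rows avoids any given
    horizontal edge, and for n even changing the parity of the columns avoids
    any given rung, so one edge never suffices when n is even
    ([edge_even_ladder_not_raises]); for n = 3 the two vertices of the middle
    column dominate without any rung ([rung_three_not_raises]).

    Finally the square with two columns has two diagonals, both dominating.  To
    spoil a diagonal both edges at a vertex of the other diagonal must be
    deleted, and to spoil both diagonals takes three edges
    ([square_raising]). *)

(** * Domination and bondage numbers *)

Section General.
Variable G : sgraph.

Lemma domination_number_leP (x : G) m :
  reflect (exists2 D : {set G}, dominating D & #|D| <= m)
          (domination_number G <= m).
Proof.
apply: (iffP idP); have [[D domD cD] minD] := domination_number_min x.
  by exists D; rewrite ?cD.
by case=> E domE; apply: leq_trans (minD _ domE).
Qed.

Lemma leq_domination_number (x : G) m :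
  (forall D : {set G}, dominating D -> m <= #|D|) -> m <= domination_number G.
Proof.
by have [[D domD <-] _] := domination_number_min x; apply.
Qed.

Lemma dominatingP (D : {set G}) (x : G) :
  reflect (forall v, v \in D \/ exists2 u, u \in D & adj v u) (dominating D).
Proof.
apply: (iffP andP) => [[_ /forallP domD] v | domD].
  by case/orP: (domD v) => [|/exists_inP[u]]; [left | right; exists u].
split; last first.
  by apply/forallP => v; apply/orP; case: (domD v) => [|[u]]; [left |
    right; apply/exists_inP; exists u].
by apply/set0Pn; case: (domD x) => [xD | [u uD _]]; [exists x | exists u].
Qed.

Lemma edgesP (e : {set G}) :
  reflect (exists a b, adj a b /\ e = [set a; b]) (e \in edges G).
Proof.
apply: (iffP imsetP) => [[[a b]] | [a [b [ab ->]]]].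
  by rewrite inE /= => ab ->; exists a, b.
by exists (a, b); rewrite ?inE.
Qed.

End General.

Lemma dominating_del_set0 (G : sgraph) (x : G) (D : {set G}) :
  dominating D -> @dominating (del_edges set0) D.
Proof.
move=> /(dominatingP _ x) domD; apply/(@dominatingP (del_edges _) _ x) => v.
have [|[u uD vu]] := domD v; [by left | right].
by exists u => //; apply/andP; rewrite inE.
Qed.

Lemma set0_not_raises (G : sgraph) (x : G) :
  ~~ raises_domination (set0 : {set {set G}}).
Proof.
apply/negP => /andP[_]; apply/negP; rewrite -leqNgt.
have [[D domD <-] _] := @domination_number_min G x.
apply/(@domination_number_leP (del_edges (set0 : {set {set G}})) x).
by exists D => //; apply: dominating_del_set0 x D domD.
Qed.

Lemma dominating_del_edges (G : sgraph) (x : G) (B : {set {set G}})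
    (D : {set G}) :
  @dominating (del_edges B) D -> dominating D.
Proof.
move=> /(@dominatingP (del_edges B) _ x) domD; apply/(dominatingP _ x) => v.
have [|[u uD /andP[vu _]]] := domD v; first by left.
by right; exists u.
Qed.

Lemma bondage_number_eq (G : sgraph) (x y : G) (B : {set {set G}}) k :
    adj x y -> raises_domination B -> #|B| <= k ->
    (forall B' : {set {set G}}, raises_domination B' -> k <= #|B'|) ->
  bondage_number G = k.
Proof.
move=> xy rB Bk lek; have [[E rE cE] minG] := bondage_number_min xy.
by apply/eqP; rewrite eqn_leq (leq_trans (minG B rB)) // -cE lek.
Qed.

Lemma two_leq_raising (G : sgraph) (x : G) (B : {set {set G}}) :
    (forall a b : G, adj a b -> ~~ raises_domination [set [set a; b]]) ->
  raises_domination B -> 2 <= #|B|.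
Proof.
move=> single rB; rewrite ltnNge; apply/negP => /[dup] B1.
case: (set_0Vmem B) => [B0 _ | [e eB]].
  by move: rB; rewrite B0; apply/negP; apply: set0_not_raises.
have Be : B = [set e].
  by apply/eqP; rewrite eq_sym eqEcard sub1set eB cards1.
have /edgesP[a [b [ab eab]]] : e \in edges G.
  by case/andP: rB => /subsetP-> .
by move: rB; rewrite Be eab (negPf (single _ _ ab)).
Qed.

(** * Column weights *)

Section Weights.
Variable c : nat -> nat.

(** Telescoping the column inequalities from the left, where the loss at the
    left end is recorded by [l]: the first two columns have total weight
    4 c_0 + 3 c_1 + c_2 in the sum, which exceeds the trivial bound by [l]. *)
Lemma weight_prefix n l :
    4 + l + c 1 <= 4 * (c 0 + c 1) + c 2 ->
    (forall i, 0 < i < n -> 2 <= c i.-1 + 2 * c i + c i.+1) ->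
  forall m, 2 <= m <= n ->
  2 * m + l + c m.-1 <= 4 * (\sum_(i < m) c i) + c m.
Proof.
move=> base step; elim=> [|m IHm] //; case: (ltngtP m 1) => [||-> _].
    by lia.
  move=> m1 mn; have := IHm; have := step m.
  rewrite big_ord_recr /=; set S := \sum_(i < m) _; lia.
by rewrite !big_ord_recr big_ord0 /=; lia.
Qed.

(** Here [l = 1]: if c_0 = 0 then c_1 >= 2, so the inequality of column 1 holds
    with slack 2, and a chosen vertex in column 0 dominates only three vertices
    and thus wastes one of the four units that it is given. *)
Lemma weight_block n :
    0 < n -> c n = 0 -> 2 <= 2 * c 0 + c 1 ->
    (forall i, 0 < i < n -> 2 <= c i.-1 + 2 * c i + c i.+1) ->
  n./2 < \sum_(i < n) c i.
Proof.
case: n => [|[|n]] // _ cn c0 step.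
  by rewrite big_ord1 /=; lia.
have := @weight_prefix n.+2 1 _ step n.+2.
have := step 1; rewrite cn /=; set S := \sum_(i < _) _; lia.
Qed.

(** Without the first rung each vertex of column 0 needs a chosen vertex in its
    own row, so the left end costs [l = 2].  The right end still costs one unit:
    if c_(n-1) = 0, then c_(n-2) >= 2 and the prefix without the last two
    columns gives the bound. *)
Lemma weight_block_no_end_rung n :
    3 < n -> c n = 0 -> 2 <= c 0 + c 1 ->
    (forall i, 0 < i < n -> 2 <= c i.-1 + 2 * c i + c i.+1) ->
  2 * n + 3 <= 4 * \sum_(i < n) c i.
Proof.
case: n => [|[|[|[|n]]]] // _ cn c0 step.
have base: 4 + 2 + c 1 <= 4 * (c 0 + c 1) + c 2 by have := step 1; lia.
have := weight_prefix base step.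
move=> pre; have := pre n.+4; have := pre n.+2.
have := step n.+3.
rewrite !big_ord_recr /= cn; set S := \sum_(i < n) _; lia.
Qed.

End Weights.

(** * Domination of a ladder, column by column *)

Lemma neq_row (j k : 'I_2) : j != k -> k = rev_ord j.
Proof.
move=> jk; apply: val_inj; move: jk; rewrite -val_eqE /=.
by have := ltn_ord j; have := ltn_ord k; lia.
Qed.

Lemma rev_row_neq (j : 'I_2) : j != rev_ord j.
Proof. by rewrite -val_eqE /=; have := ltn_ord j; lia. Qed.

Lemma rev_row0 : rev_ord (ord0 : 'I_2) = ord_max.
Proof. exact: val_inj. Qed.

Lemma rev_row1 : rev_ord (ord_max : 'I_2) = ord0.
Proof. exact: val_inj. Qed.

Section Ladder.
Variable n : nat.
Implicit Types u v : mesh n 2.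

Lemma ladder_adjE u v :
  adj u v = ((u.1 == v.1 :> nat) && (u.2 != v.2 :> nat)) ||
            ((u.2 == v.2 :> nat) && ((u.1.+1 == v.1) || (v.1.+1 == u.1))).
Proof.
case: u v => [i j] [k l] /=; rewrite /mesh_adj /=.
by have := ltn_ord j; have := ltn_ord l; lia.
Qed.

Definition occupied (D : {set mesh n 2}) (i : nat) (j : 'I_2) : bool :=
  [exists v in D, (v.1 == i :> nat) && (v.2 == j)].

Definition column_weight (D : {set mesh n 2}) (i : nat) : nat :=
  \sum_(j < 2) occupied D i j.

Lemma mem_occupied (D : {set mesh n 2}) v :
  v \in D -> occupied D v.1 v.2.
Proof. by move=> vD; apply/exists_inP; exists v; rewrite ?eqxx. Qed.

Lemma column_weight_out (D : {set mesh n 2}) i :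
  n <= i -> column_weight D i = 0.
Proof.
move=> ni; apply: big1 => j _; apply/eqP; rewrite eqb0.
apply/exists_inP => -[v _ /andP[/eqP vi _]].
by have := ltn_ord v.1; rewrite vi ltnNge ni.
Qed.

Lemma sum_column_weight (D : {set mesh n 2}) :
  \sum_(i < n) column_weight D i = #|D|.
Proof.
rewrite /column_weight pair_bigA /= -sum1_card [RHS]big_mkcond /=.
apply: eq_bigr => v _; case: ifPn => vD; first by rewrite mem_occupied.
apply/eqP; rewrite eqb0; apply: contra vD => /exists_inP[w wD].
by case: v w wD => i j [i' j'] wD /= /andP[/eqP/val_inj <- /eqP <-].
Qed.

(** The flags [r], [l] and [h] say whether the rung of column [i] and the edges
    towards the previous and the next column may be used.  The inequality is the
    sum of the domination conditions of the two vertices of the column: a chosen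
    vertex of the column counts once for itself and once for its rung, a chosen
    vertex of a neighbouring column counts for its row. *)
Lemma column_cover (B : {set {set mesh n 2}}) (D : {set mesh n 2}) i
    (r l h : bool) :
    @dominating (del_edges B) D -> i < n ->
    (forall u v, adj u v -> [set u; v] \notin B -> u.1 = i :> nat ->
       [|| r && (v.1 == i :> nat), l && (v.1.+1 == i)
         | h && (v.1 == i.+1 :> nat)]) ->
  2 <= (1 + r) * column_weight D i + l * column_weight D i.-1
       + h * column_weight D i.+1.
Proof.
move=> /(@dominatingP (del_edges B)) domD lt_in near.
have cover (j : 'I_2) : 1 <= occupied D i j + r * occupied D i (rev_ord j)
    + l * occupied D i.-1 j + h * occupied D i.+1 j.
  pose v : mesh n 2 := (Ordinal lt_in, j).
  have [/mem_occupied/= -> // | [u /mem_occupied uD /andP[vu uB]]] := domD v v.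
  have := near _ _ vu uB erefl; move: vu; rewrite ladder_adjE /=.
  case/orP=> [/andP[ui ju] | /andP[/eqP/val_inj ju _]].
    have {}ui : Ordinal lt_in = u.1 by apply/val_inj/eqP.
    have uj : u.2 = rev_ord j by apply: neq_row.
    rewrite -ui /= => rlh; have -> : r = true by move: rlh; lia.
    by move: uD; rewrite -ui uj /= => ->; lia.
  rewrite -ju /= in uD.
  case/or3P=> /andP[-> /eqP ui]; move: uD; first by rewrite ui => ->; lia.
    by rewrite -ui => /= ->; lia.
  by rewrite ui => ->; lia.
have := cover ord0; have := cover ord_max.
rewrite rev_row0 rev_row1.
rewrite /column_weight !big_ord_recl !big_ord0.
have -> : lift ord0 ord0 = ord_max :> 'I_2 by apply: val_inj.
case: r l h {near cover} => -[] [] /=; lia.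
Qed.

End Ladder.

(** * Zigzag dominating sets *)

Section Zigzag.
Variable n : nat.
Implicit Types (u v w : mesh n.+1 2) (B : {set {set mesh n.+1 2}}).

(** The vertex number [t] is in column 2t (or 2t - 1 if [p]) and its row is
    given by the parity of t, shifted by [s].  Truncation to the columns of the
    ladder yields the additional vertex in an end column: the first column
    if [p], the last one if [p] fails and the number of columns is even. *)
Definition zigzag (p s : bool) : {set mesh n.+1 2} :=
  [set (inord (minn (t.*2 - p) n), inord (odd t (+) s)) | t : 'I_(n.+1./2.+1)].

Lemma leq_card_zigzag p s : #|zigzag p s| <= n.+1./2.+1.
Proof. by rewrite -[leqRHS]card_ord leq_imset_card. Qed.

Lemma mem_zigzag (p s : bool) v t : t <= n.+1./2 ->
  v.1 = minn (t.*2 - p) n :> nat -> v.2 = odd t (+) s :> nat ->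
  v \in zigzag p s.
Proof.
rewrite -ltnS => lt_t v1 v2; apply/imsetP; exists (Ordinal lt_t) => //=.
by case: v v1 v2 => i j /= <- <-; rewrite !inord_val.
Qed.

(** Every vertex outside the zigzag has a neighbour in it that lies in a column of
    parity [p]: in such a column this is the other end of the rung; in
    the other columns the two neighbouring columns have chosen vertices in
    opposite rows.  Hence only the edges at those vertices must survive.  If [p]
    holds, the last column must have parity [p], since otherwise its vertices
    have only one neighbouring column. *)
Lemma zigzag_dominates B (p s : bool) :
    (p -> odd n) ->
    (forall u w, adj u w -> odd w.1 = p ->
       w.2 = odd (uphalf w.1) (+) s :> nat -> [set u; w] \notin B) ->
  @dominating (del_edges B) (zigzag p s).
Proof.
move=> pn freeB; apply/(@dominatingP (del_edges B) _ (ord0, ord0)) => -[i j].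
have lt_i := ltn_ord i; have lt_j := ltn_ord j.
have dominator (k : nat) (l : bool) : k <= n -> odd k = p ->
    l = odd (uphalf k) (+) s ->
    ((k == i) && (j != l :> nat)) ||
      ((j == l :> nat) && ((k.+1 == i) || (k == i.+1))) ->
    exists2 u : mesh n.+1 2, u \in zigzag p s &
      @adj (del_edges B) (i, j) u.
  move=> le_kn kp lE near; have lt_l : l < 2 by case: (l).
  pose w : mesh n.+1 2 := (inord k, inord l).
  have w1 : w.1 = k :> nat by rewrite inordK.
  have w2 : w.2 = l :> nat by rewrite inordK.
  have iw : adj ((i, j) : mesh n.+1 2) w.
    by rewrite ladder_adjE /= !inordK //; move: near; lia.
  exists w.
    by apply: (@mem_zigzag _ _ _ (uphalf k)); rewrite ?w1 ?w2 ?lE; lia.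
  by apply/andP; split=> //; apply: freeB; rewrite ?w1 ?w2 ?lE.
have [ip | ip] := eqVneq (odd i) p.
  have [jE | jE] := eqVneq (j : nat) (odd (uphalf i) (+) s).
    by left; apply: (@mem_zigzag _ _ _ (uphalf i)) => //=; lia.
  by right; apply: (dominator i (odd (uphalf i) (+) s)); rewrite ?eqxx ?jE.
have [jE | jE] := eqVneq (j : nat) (odd i./2 (+) s).
  (* A first column of the wrong parity contains the additional vertex. *)
  case: (posnP i) => [i0 | i_gt0].
    by left; apply: (@mem_zigzag _ _ _ 0) => //=; lia.
  by right; apply: (dominator i.-1 (odd i./2 (+) s)); lia.
have jE' : (j : nat) = odd (i./2.+1) (+) s by lia.
case: (ltngtP i n) => [lt_in | | i_n]; last 2 first.
- by lia.
(* The truncated vertex of the zigzag is in the last column. *)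
- by left; apply: (@mem_zigzag _ _ _ i./2.+1) => //=; lia.
by right; apply: (dominator i.+1 (odd i./2.+1 (+) s)); lia.
Qed.

End Zigzag.

(** * The domination number of a ladder *)

Lemma ladder_column_cover n (B : {set {set mesh n 2}}) (D : {set mesh n 2}) i :
    @dominating (del_edges B) D -> i < n ->
  2 <= 2 * column_weight D i + (0 < i) * column_weight D i.-1
       + column_weight D i.+1.
Proof.
move=> domD lt_in; have := @column_cover n B D i true (0 < i) true domD lt_in.
rewrite mul1n; apply=> u v; rewrite ladder_adjE => uv _ ui; move: uv.
by rewrite ui; lia.
Qed.

Lemma ladder_domination_number n :
  domination_number (mesh n.+1 2) = n.+1./2.+1.
Proof.
pose x : mesh n.+1 2 := (ord0, ord0).
apply/eqP; rewrite eqn_leq; apply/andP; split.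
  apply/(domination_number_leP x); exists (zigzag n false false).
    apply: (dominating_del_edges x (B := set0)).
    by apply: zigzag_dominates => // *; rewrite inE.
  exact: leq_card_zigzag.
apply: (leq_domination_number x) => D /(dominating_del_set0 x) domD.
rewrite -sum_column_weight; have cover := ladder_column_cover domD.
apply: weight_block => // [||i]; first exact: column_weight_out.
  by have := cover 0 isT; rewrite mul0n addn0.
by case/andP=> i_gt0 /cover; rewrite i_gt0 mul1n addnC addnCA addnA; lia.
Qed.

(** * Deletions that do not raise the domination number *)

Lemma small_dominating_not_raises n (B : {set {set mesh n.+1 2}})
    (D : {set mesh n.+1 2}) :
    @dominating (del_edges B) D -> #|D| <= n.+1./2.+1 ->
  ~~ raises_domination B.
Proof.
move=> domD cD; apply/negP => /andP[_]; apply/negP.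
rewrite -leqNgt ladder_domination_number.
by apply/(@domination_number_leP (del_edges B) (ord0, ord0)); exists D.
Qed.

Lemma zigzag_avoiding_not_raises n (B : {set {set mesh n.+1 2}}) (p s : bool) :
    (p -> odd n) ->
    (forall u w : mesh n.+1 2, adj u w -> odd w.1 = p ->
       w.2 = odd (uphalf w.1) (+) s :> nat -> [set u; w] \notin B) ->
  ~~ raises_domination B.
Proof.
move=> pn avoid; apply: small_dominating_not_raises (leq_card_zigzag n p s).
exact: zigzag_dominates.
Qed.

(** In a column of the other parity a zigzag may contain an end of the edge: such
    a vertex is not used to dominate another one. *)
Lemma edge_not_raises n (a b : mesh n.+1 2) (p s : bool) :
    (p -> odd n) ->
    (forall w, w \in [set a; b] -> odd w.1 = p ->
       w.2 != odd (uphalf w.1) (+) s :> nat) ->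
  ~~ raises_domination [set [set a; b]].
Proof.
move=> pn avoid; apply: (zigzag_avoiding_not_raises (p := p) (s := s)) => //.
move=> u w _ wp ws; rewrite inE; apply/eqP => uw_ab.
have wab : w \in [set a; b] by rewrite -uw_ab !inE eqxx orbT.
by move/eqP: (avoid w wab wp).
Qed.

(** Take the zigzag on the even columns: exactly one end of the edge is in an even
    column, and choosing the starting row keeps this end out of the zigzag. *)
Lemma horizontal_edge_not_raises n (a b : mesh n.+1 2) :
  adj a b -> a.1 != b.1 :> nat -> ~~ raises_domination [set [set a; b]].
Proof.
move=> ab a1b1.
wlog evena : a b ab a1b1 / ~~ odd a.1.
  move=> wlog_even; have [odda | ] := boolP (odd a.1); last exact: wlog_even.
  rewrite setUC; apply: wlog_even; rewrite 1?adj_sym 1?eq_sym //.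
  by move: ab a1b1; rewrite ladder_adjE; lia.
pose s := ~~ (odd (uphalf a.1) (+) (a.2 == 1 :> nat)).
apply: (@edge_not_raises _ a b false s) => //.
have lt_a2 := ltn_ord a.2; rewrite /s => w.
rewrite !inE => /orP[]/eqP-> w1; first by lia.
by move: ab a1b1; rewrite ladder_adjE; lia.
Qed.

(** A rung in column i is avoided by a zigzag on the columns whose parity differs
    from that of i; both parities are available in a ladder of even length. *)
Lemma edge_even_ladder_not_raises n (a b : mesh n.+1 2) :
  odd n -> adj a b -> ~~ raises_domination [set [set a; b]].
Proof.
move=> oddn ab; have [a1b1 | a1b1] := eqVneq (a.1 : nat) b.1; last first.
  exact: horizontal_edge_not_raises.
apply: (@edge_not_raises _ a b (~~ odd a.1) false) => // w.
by rewrite !inE => /orP[]/eqP->; rewrite -?a1b1; case: odd.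
Qed.

(** The middle column dominates the others through horizontal edges. *)
Lemma rung_three_not_raises (a b : mesh 3 2) :
  adj a b -> a.1 = b.1 :> nat -> ~~ raises_domination [set [set a; b]].
Proof.
move=> ab a1b1.
pose D : {set mesh 3 2} := [set (inord 1, j) | j : 'I_2].
have cD : #|D| <= 2 by rewrite -[leqRHS](card_ord 2) leq_imset_card.
apply: small_dominating_not_raises (cD).
apply/(@dominatingP (del_edges [set [set a; b]]) _ (ord0, ord0)) => -[i j].
have jD : (inord 1, j) \in D by apply: imset_f.
have [i1 | i1] := eqVneq (i : nat) 1.
  by left; rewrite -[i]inord_val i1.
right; exists (inord 1, j) => //; apply/andP; split.
  rewrite ladder_adjE /= inordK //; have := ltn_ord i; lia.
rewrite inE; apply: contra i1 => /eqP ij_ab.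
have col (w : mesh 3 2) : w \in [set a; b] -> w.1 = a.1 :> nat.
  by rewrite !inE => /orP[]/eqP->.
have := col (i, j); have := col (inord 1, j).
rewrite -ij_ab !inE !eqxx orbT /= => <- // -> //.
by rewrite inordK.
Qed.

(** * Deletions that raise the domination number *)

Definition rung n (i : 'I_n) : {set mesh n 2} := [set (i, ord0); (i, ord_max)].

Lemma rung_edge n (i : 'I_n) : rung i \in edges (mesh n 2).
Proof.
by apply/edgesP; exists (i, ord0), (i, ord_max); rewrite ladder_adjE /= eqxx.
Qed.

Lemma rungE n (u v : mesh n 2) (i : 'I_n) : adj u v -> u.1 = i -> v.1 = i ->
  [set u; v] = rung i.
Proof.
move=> uv ui vi; have {uv} : u.2 != v.2.
  by move: uv; rewrite ladder_adjE ui vi -val_eqE /=; lia.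
case: u v ui vi => [k j] [l j'] /= -> -> /neq_row->.
have [->|/neq_row] := eqVneq j ord0; first by rewrite rev_row0.
move/(congr1 (@rev_ord 2)); rewrite rev_ordK rev_row0 setUC => <-.
by rewrite rev_row1.
Qed.

(** The edges between columns [k - 1] and [k]. *)
Definition cut n k : {set {set mesh n.+1 2}} :=
  [set [set (inord k.-1, j); (inord k, j)] | j : 'I_2].

Lemma card_cut n k : #|cut n k| <= 2.
Proof. by rewrite -[leqRHS](card_ord 2) leq_imset_card. Qed.

Lemma cut_edges n k : 0 < k <= n -> cut n k \subset edges (mesh n.+1 2).
Proof.
move=> k_n; apply/subsetP => _ /imsetP[j _ ->].
apply/edgesP; exists (inord k.-1, j), (inord k, j); split=> //.
by rewrite ladder_adjE /= !inordK; lia.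
Qed.

Lemma mem_cut n k (u v : mesh n.+1 2) :
  adj u v -> u.1.+1 = k -> v.1 = k :> nat -> [set u; v] \in cut n k.
Proof.
move=> uv uk vk; have {uv} : u.2 = v.2 :> nat.
  by move: uv; rewrite ladder_adjE; lia.
case: u v uk vk => [i j] [i' j'] /= <- i'E /val_inj <-.
by apply/imsetP; exists j; rewrite //= -i'E !inord_val.
Qed.

(** The rung of column [i] is recorded as well, since the square needs the
    deletion of a cut together with a rung. *)
Lemma cut_column_cover n k (B : {set {set mesh n.+1 2}}) (D : {set mesh n.+1 2})
    i : cut n k \subset B -> @dominating (del_edges B) D -> i <= n ->
  2 <= (1 + (rung (inord i : 'I_n.+1) \notin B)) * column_weight D i
       + ((0 < i) && (i != k)) * column_weight D i.-1
       + (i.+1 != k) * column_weight D i.+1.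
Proof.
move=> /subsetP cutB domD le_in; apply: (column_cover domD) => // u v uv uvB ui.
have right_i : v.1 = i.+1 :> nat -> i.+1 != k.
  move=> vi; apply: contra uvB => /eqP ik; apply: cutB.
  by apply: mem_cut; rewrite ?ui ?vi.
have left_i : v.1.+1 = i :> nat -> i != k.
  move=> vi; apply: contra uvB => /eqP ik; apply: cutB.
  by rewrite setUC; apply: mem_cut; rewrite 1?adj_sym ?ui ?vi.
have rung_i : rung (inord i : 'I_n.+1) \in B -> v.1 != i :> nat.
  move=> rB; apply: contra uvB => /eqP vi; rewrite (rungE (i := inord i) uv) //.
    by rewrite -ui inord_val.
  by rewrite -vi inord_val.
by move: uv rung_i; rewrite ladder_adjE ui; lia.
Qed.

(** Deleting the cut leaves two ladders, with [k] and [n + 1 - k] columns, to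
    which the bound on the weights applies separately. *)
Lemma cut_domination n k (B : {set {set mesh n.+1 2}}) :
  0 < k <= n -> cut n k \subset B ->
  k./2.+1 + (n.+1 - k)./2.+1 <= domination_number (del_edges B).
Proof.
move=> kn cutB.
apply: (@leq_domination_number (del_edges B) (ord0, ord0)) => D domD.
set c := column_weight D.
have cover i : i <= n ->
    2 <= 2 * c i + ((0 < i) && (i != k)) * c i.-1 + (i.+1 != k) * c i.+1.
  move/(cut_column_cover cutB domD)/leq_trans; apply; rewrite !leq_add2r.
  by rewrite leq_mul2r; case: (_ \in B); rewrite orbT.
rewrite -(sum_column_weight D) -/c -(big_mkord xpredT).
rewrite (@big_cat_nat _ _ _ k) /=; [|lia|lia].
have -> : \sum_(k <= i < n.+1) c i = \sum_(i < n.+1 - k) c (k + i).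
  rewrite -{1}[k]add0n big_addn big_mkord.
  by apply: eq_bigr => i _; rewrite addnC.
rewrite big_mkord; apply: leq_add.
  (* The weights of the left part are extended by zero to column k. *)
  pose c1 i := (i < k) * c i.
  have -> : \sum_(i < k) c i = \sum_(i < k) c1 i.
    by apply: eq_bigr => i _; rewrite /c1 ltn_ord mul1n.
  apply: weight_block; rewrite /c1 ?ltnn //; first by lia.
    by have := cover 0 isT; case: eqVneq; lia.
  move=> i ik; have := cover i; case: eqVneq; lia.
apply: (@weight_block (fun i => c (k + i))); first lia.
- by rewrite subnKC; [apply: column_weight_out | lia].
- have := cover k; rewrite eqxx addn0 addn1.
  by case: eqVneq; lia.
move=> i ik; have := cover (k + i).
have -> : (k + i).-1 = k + i.-1 by lia.
have -> : k + i.+1 = (k + i).+1 by lia.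
by case: eqVneq; lia.
Qed.

Lemma end_rung_domination n : 3 <= n -> ~~ odd n ->
  n.+1./2.+2 <= domination_number (del_edges [set rung (ord0 : 'I_n.+1)]).
Proof.
move=> n3 evn; set B := [set _].
apply: (@leq_domination_number (del_edges B) (ord0, ord0)) => D domD.
suff: 2 * n.+1 + 3 <= 4 * #|D| by lia.
rewrite -(sum_column_weight D); apply: weight_block_no_end_rung => //.
- exact: column_weight_out.
- have := @column_cover _ B D 0 false false true domD isT.
  rewrite !mul1n addn0 => -> // u v uv uvB u0.
  have v0 : v.1 != 0 :> nat.
    apply: contra uvB => /eqP v0; rewrite inE.
    by rewrite (rungE (i := ord0) uv) //; apply: val_inj.
  by move: uv; rewrite ladder_adjE; lia.
by move=> i /andP[i0 lt_i]; have := ladder_column_cover domD lt_i; lia.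
Qed.

(** * Ladders with at least three columns *)

Lemma raises_ladder n (B : {set {set mesh n.+1 2}}) :
  B \subset edges (mesh n.+1 2) ->
  n.+1./2.+2 <= domination_number (del_edges B) ->
  raises_domination B.
Proof.
by move=> BE; rewrite /raises_domination BE ladder_domination_number.
Qed.

Lemma end_rung_adj n : @adj (mesh n.+1 2) (ord0, ord0) (ord0, ord_max).
Proof. by rewrite ladder_adjE. Qed.

Lemma bondage_even_ladder n : odd n -> 3 <= n -> bondage_number (mesh n.+1 2) = 2.
Proof.
move=> oddn n3; have k2 : 0 < 2 <= n by lia.
apply: (bondage_number_eq (end_rung_adj n) (B := cut n 2)); last first.
- move=> B; apply: (@two_leq_raising (mesh n.+1 2) (ord0, ord0)) => a b.
  exact: edge_even_ladder_not_raises.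
- exact: card_cut.
apply: raises_ladder; first exact: cut_edges.
by have := cut_domination k2 (subxx _); lia.
Qed.

Lemma bondage_odd_ladder n : ~~ odd n -> 3 <= n -> bondage_number (mesh n.+1 2) = 1.
Proof.
move=> evn n3.
apply: (bondage_number_eq (end_rung_adj n) (B := [set rung ord0])).
- apply: raises_ladder; first by rewrite sub1set rung_edge.
  exact: end_rung_domination.
- by rewrite cards1.
move=> B rB; rewrite card_gt0; apply: contraL rB => /eqP->.
exact: (@set0_not_raises (mesh n.+1 2) (ord0, ord0)).
Qed.

Lemma bondage_three : bondage_number (mesh 3 2) = 2.
Proof.
have k1 : 0 < 1 <= 2 by [].
apply: (bondage_number_eq (end_rung_adj 2) (B := cut 2 1)).
- apply: raises_ladder; first exact: cut_edges.
  exact: cut_domination k1 (subxx _).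
- exact: card_cut.
move=> B; apply: (@two_leq_raising (mesh 3 2) (ord0, ord0)) => a b ab.
have [a1b1 | a1b1] := eqVneq (a.1 : nat) b.1.
  exact: rung_three_not_raises.
exact: horizontal_edge_not_raises.
Qed.

(** * The square *)

Definition beam (j : 'I_2) : {set mesh 2 2} := [set (ord0, j); (ord_max, j)].

Lemma beamE (i j : 'I_2) : [set (i, j); (rev_ord i, j)] = beam j.
Proof.
have [->|/neq_row i0] := eqVneq i ord0; first by rewrite rev_row0.
by rewrite -i0 -[i]rev_ordK -i0 rev_row0 setUC.
Qed.

Definition diagonal (s : bool) : {set mesh 2 2} :=
  [set v | v.2 == if s then rev_ord v.1 else v.1].

Lemma card_diagonal s : #|diagonal s| <= 2.
Proof.
rewrite -[leqRHS](card_ord 2).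
apply: leq_trans (leq_imset_card (fun i => (i, if s then rev_ord i else i)) _).
apply/subset_leq_card/subsetP => -[i j]; rewrite inE /= => /eqP->.
exact: imset_f.
Qed.

Lemma diagonal_dominates (B : {set {set mesh 2 2}}) s :
    (forall v : mesh 2 2, v \notin diagonal s ->
       (rung v.1 \notin B) || (beam v.2 \notin B)) ->
  @dominating (del_edges B) (diagonal s).
Proof.
move=> free; apply/(@dominatingP (del_edges B) _ (ord0, ord0)) => -[i j].
have [|vD] := boolP ((i, j) \in diagonal s); [by left | right].
have jE : j = if s then i else rev_ord i.
  move: vD; rewrite inE eq_sym /= => /neq_row->.
  by case: s {free}; rewrite ?rev_ordK.
case/orP: (free _ vD) => /= [rB | bB].
  have adj_ij : adj ((i, j) : mesh 2 2) (i, rev_ord j).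
    by rewrite ladder_adjE eqxx rev_row_neq.
  exists (i, rev_ord j).
    by rewrite inE jE; case: s {free vD jE}; rewrite /= ?rev_ordK.
  by apply/andP; split; rewrite // (@rungE _ _ _ i).
exists (rev_ord i, j).
  by rewrite inE jE; case: s {free vD jE}; rewrite /= ?rev_ordK.
apply/andP; split; last by rewrite beamE.
by rewrite ladder_adjE /=; have := ltn_ord i; lia.
Qed.

(** If both edges at a vertex v outside one diagonal and both edges at a vertex v'
    outside the other diagonal are deleted, then v and v' are adjacent, so that
    these are three edges. *)
Lemma square_raising (B : {set {set mesh 2 2}}) :
  raises_domination B -> 3 <= #|B|.
Proof.
move=> rB.
have blocked s :
    exists i, rung i \in B /\ beam (if s then i else rev_ord i) \in B.
  have [v vD] : exists2 v, v \notin diagonal s &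
      (rung v.1 \in B) && (beam v.2 \in B).
    apply/exists_inP; apply: contraLR rB => /exists_inPn free.
    apply: small_dominating_not_raises (card_diagonal s).
    by apply: diagonal_dominates => v /free; rewrite negb_and.
  case: v vD => i j; rewrite inE eq_sym /= => /neq_row -> /andP[rB' bB].
  by exists i; split=> //; move: bB; case: (s); rewrite ?rev_ordK.
have rung_neq (i : 'I_2) : rung i != rung (rev_ord i).
  apply/eqP => /setP/(_ (i, ord0)).
  by rewrite !inE !xpair_eqE eqxx (negPf (rev_row_neq _)).
have beam_neq (i : 'I_2) : beam i != beam (rev_ord i).
  apply/eqP => /setP/(_ (ord0, i)).
  by rewrite !inE !xpair_eqE !eqxx (negPf (rev_row_neq _)).
have rung_beam (i j : 'I_2) : rung i != beam j.
  apply/eqP => /setP/(_ (rev_ord i, j)); rewrite -(beamE i) !inE !xpair_eqE !eqxx.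
  by rewrite eq_sym (negPf (rev_row_neq _)).
have [i [ri bi]] := blocked true; have [i' [ri' bi']] := blocked false.
(* The two vertices share a column in the first case, a row in the second. *)
apply/card_gt2P; have [ii' | /neq_row i'E] := eqVneq i i'.
  exists (rung i), (beam i), (beam (rev_ord i)); split; split=> //.
    by rewrite ii'.
  by rewrite eq_sym.
exists (beam i), (rung i), (rung (rev_ord i)); split; split; rewrite // -?i'E //.
by rewrite eq_sym.
Qed.

(** Only the rung of the second column remains, so both vertices of the first
    column and one of the second must be chosen. *)
Lemma bondage_square : bondage_number (mesh 2 2) = 3.
Proof.
apply: (bondage_number_eq (end_rung_adj 1) (B := rung ord0 |: cut 1 1)).
- apply: raises_ladder; first by rewrite subUset sub1set rung_edge cut_edges.
  set B := _ |: _; have cutB : cut 1 1 \subset B by apply: subsetUr.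
  apply: (@leq_domination_number (del_edges B) (ord0, ord0)) => D domD.
  have := cut_column_cover cutB domD (leq0n 1).
  have := cut_column_cover cutB domD (leqnn 1).
  have -> : inord 0 = ord0 :> 'I_2 by apply: val_inj; rewrite /= inordK.
  have c2 : column_weight D 2 = 0 by apply: column_weight_out.
  rewrite c2 setU11 -(sum_column_weight D) !big_ord_recl big_ord0 /=.
  by rewrite /bump /= !addn0; case: (_ \in B); lia.
- by rewrite cardsU1; have := card_cut 1 1; case: (_ \in _) => /=; lia.
exact: square_raising.
Qed.

(** * All ladders *)

Theorem theorem3p1 :
  [/\ bondage_number (mesh 2 2) = 3,
      bondage_number (mesh 3 2) = 2
    & forall n : nat, 4 <= n ->
        (odd n -> bondage_number (mesh n 2) = 1) /\
        (~~ odd n -> bondage_number (mesh n 2) = 2)].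
Proof.
split; [exact: bondage_square | exact: bondage_three | case=> [|n] // n3].
by split=> [/bondage_odd_ladder|]; [apply | rewrite negbK => /bondage_even_ladder; apply].
Qed.
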